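(* Let $m\in\{1,2,\ldots\}$ and $\rho>0$. Then $\mathrm{Tr}_\rho(S_\rho)=\mathrm{bd}_\rho$, and $\mathrm{Tr}_\rho:S_\rho\to\mathrm{bd}_\rho$, $\mathrm{Tr}_\rho(M)=(\partial^0_\rho M,\partial^1_\rho M)$, is a bijection with inverse \[\mathrm{Tr}_\rho^{-1}(D_0,D_1)=\begin{cases}M(D_0,D_1),&(D_0,D_1)\in\mathrm{bd}_\rho^-,\\ \Delta_\rho,&(D_0,D_1)=(\emptyset,\emptyset).\end{cases}\]
   Context: $\mathbb{R}^m$ carries the maximum norm $\|x\|_\infty=\max_{1\le j\le m}|x_j|$. For nonempty $A,A'\subset\mathbb{R}^m$ let $\mathrm{d}(A,A')=\sup_{x\in A}\inf_{x'\in A'}\|x-x'\|_\infty$, with $\mathrm{d}(A,\emptyset)=\infty$ for nonempty $A$; for a point $x$, $\mathrm{d}(x,A)=\mathrm{d}(\{x\},A)$. $M^c$ is the complement in $\mathbb{R}^m$. Grid: $\Delta_\rho=\rho\mathbb{Z}^m$. $S_\rho=\{M\subset\Delta_\rho:M\neq\emptyset\}$, $S_\rho^+=2^{\Delta_\rho}$ (all subsets). For $M\in S_\rho^+$: $\partial^0_\rho M=\{x\in M:\exists z\in M^c\cap\Delta_\rho,\ \|x-z\|_\infty=\rho\}$ and $\partial^1_\rho M=\{z\in M^c\cap\Delta_\rho:\mathrm{d}(z,\partial^0_\rho M)=\rho\}$. Paths: for $x,z\in\Delta_\rho$, $P_\rho(x,z)$ is the set of finite sequences $p=(\xi_0,\ldots,\xi_k)$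 in $\Delta_\rho$, $k\in\{0,1,2,\ldots\}$, with $\xi_0=x$, $\xi_k=z$ and $\|\xi_\ell-\xi_{\ell-1}\|_\infty\le\rho$ for $\ell=1,\ldots,k$; $L(p)=k$ and $p(\ell)=\xi_\ell$. Boundary pairs: $\mathrm{bd}_\rho^-\subset S_\rho^+\times S_\rho^+$ is the set of all pairs $(D_0,D_1)$ such that (1) $D_0\neq\emptyset\neq D_1$; (2) $D_0\cap D_1=\emptyset$; (3) for every $x\in D_0$ there is $z\in D_1$ with $\|x-z\|_\infty=\rho$; (4) for every $z\in D_1$ there is $x\in D_0$ with $\|x-z\|_\infty=\rho$; (5) for all $x\in D_0$, $z\in D_1$ and $p\in P_\rho(x,z)$ with $L(p)>1$ there is an integer $\ell$ with $0<\ell<L(p)$ and $p(\ell)\in D_0\cup D_1$. Moreover $\mathrm{bd}_\rho=\mathrm{bd}_\rho^-\cup\{(\emptyset,\emptyset)\}$. For $(D_0,D_1)\in\mathrm{bd}_\rho^-$: $M(D_0,D_1)=\{x\in\Delta_\rho:\mathrm{d}(x,D_0)<\mathrm{d}(x,D_1)\}$. $\mathrm{Tr}_\rho:S_\rho\to S_\rho^+\times S_\rho^+$ is defined by $\mathrm{Tr}_\rho(M)=(\partial^0_\rho M,\partial^1_\rho M)$. *)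

(* Defs.v *)
From HB Require Import structures.
From mathcomp Require Import all_boot all_order all_algebra.
From mathcomp Require Import all_classical all_reals all_analysis.

Set Implicit Arguments.
Unset Strict Implicit.
Unset Printing Implicit Defensive.

Import Order.TTheory GRing.Theory Num.Theory.
Import numFieldNormedType.Exports.
Local Open Scope classical_set_scope.
Local Open Scope ring_scope.

(* R^m is 'rV[R]_m, whose library norm `|x| is the maximum norm (mx_norm). *)

Section GridBoundaries.
Context {R : realType}.

(* Extended-real valued, so that setdist A set0 = +oo for A nonempty. For A
   empty the value is the junk -oo; it is never used below. *)
Definition setdist m (A A' : set 'rV[R]_m) : \bar R :=
  ereal_sup [set ereal_inf [set (`|x - x'|)%:E | x' in A'] | x in A].

Definition ptdist m (x : 'rV[R]_m) (A : set 'rV[R]_m) : \bar R :=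
  setdist [set x] A.

Definition grid m (rho : R) : set 'rV[R]_m :=
  [set x | exists k : 'rV[int]_m, x = rho *: map_mx (fun a : int => a%:~R) k].

Definition Splus m (rho : R) : set (set 'rV[R]_m) :=
  [set M | M `<=` grid rho].

Definition Sne m (rho : R) : set (set 'rV[R]_m) :=
  [set M | M `<=` grid rho /\ M !=set0].

Definition bdry0 m (rho : R) (M : set 'rV[R]_m) : set 'rV[R]_m :=
  [set x | M x /\ exists2 z, (~` M `&` grid rho) z & `|x - z| = rho].

Definition bdry1 m (rho : R) (M : set 'rV[R]_m) : set 'rV[R]_m :=
  [set z | (~` M `&` grid rho) z /\ ptdist z (bdry0 rho M) = rho%:E].

(* A path (xi_0, ..., xi_k) is the sequence of its k + 1 points: its length
   L(p) is k, and p(l) is p`_l. *)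
Definition pathlen m (p : seq 'rV[R]_m) : nat := (size p).-1.

Definition gridpaths m (rho : R) (x z : 'rV[R]_m) : set (seq 'rV[R]_m) :=
  [set p | [/\ (0 < size p)%N,
               forall xi, xi \in p -> grid rho xi,
               p`_0 = x,
               p`_(pathlen p) = z &
               forall l : nat, (0 < l <= pathlen p)%N ->
                 `|p`_l - p`_l.-1| <= rho]].

Record boundary_pair m (rho : R) (D0 D1 : set 'rV[R]_m) : Prop :=
  BoundaryPair {
    bp_sub : Splus rho D0 /\ Splus rho D1;
    bp_neq0 : D0 !=set0 /\ D1 !=set0;
    bp_disj : D0 `&` D1 = set0;
    bp_out : forall x, D0 x -> exists2 z, D1 z & `|x - z| = rho;
    bp_in : forall z, D1 z -> exists2 x, D0 x & `|x - z| = rho;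
    bp_sep : forall x z p, D0 x -> D1 z -> gridpaths rho x z p ->
      (1 < pathlen p)%N ->
      exists2 l : nat, (0 < l < pathlen p)%N & (D0 `|` D1) p`_l }.

Definition bd_minus m (rho : R) : set (set 'rV[R]_m * set 'rV[R]_m) :=
  [set D | boundary_pair rho D.1 D.2].

Definition bd m (rho : R) : set (set 'rV[R]_m * set 'rV[R]_m) :=
  bd_minus rho `|` [set (set0, set0)].

Definition fill m (rho : R) (D0 D1 : set 'rV[R]_m) : set 'rV[R]_m :=
  [set x | grid rho x /\ (ptdist x D0 < ptdist x D1)%E].

Definition Tr m (rho : R) (M : set 'rV[R]_m) : set 'rV[R]_m * set 'rV[R]_m :=
  (bdry0 rho M, bdry1 rho M).

(* Only meaningful on bd rho, where the second case is D = (set0, set0). *)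
Definition Tr_inv m (rho : R) (D : set 'rV[R]_m * set 'rV[R]_m) :
    set 'rV[R]_m :=
  if `[< bd_minus rho D >] then fill rho D.1 D.2 else grid rho.

End GridBoundaries.

Arguments grid {R} m rho.
Arguments Splus {R} m rho.
Arguments Sne {R} m rho.
Arguments bd_minus {R} m rho.
Arguments bd {R} m rho.

(* Main.v *)
Require Import Defs.
From HB Require Import structures.
From mathcomp Require Import all_boot all_order all_algebra.
From mathcomp Require Import all_classical all_reals all_analysis.
From mathcomp Require Import zify lra.

Import Order.TTheory GRing.Theory Num.Theory.
Import numFieldNormedType.Exports.
Local Open Scope classical_set_scope.
Local Open Scope ring_scope.

(** The proof is discrete connectedness of the grid. Two grid points at
    distance [n * rho] are joined by a path of [n] steps of size at most [rho],
    because all coordinates can move simultaneously ([grid_step]).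

    From [M] to its boundary and back. If [M] is neither empty nor the whole
    grid, a path from a point of [M] to a point outside [M] has two consecutive
    points [y] in [M] and [y'] outside, and then [y] lies in the inner and [y']
    in the outer boundary ([bdry_adjacent]). This shows that both boundaries are
    nonempty and separate paths, i.e. form a boundary pair ([Tr_boundary_pair]).
    Applied to a shortest path from a point of [M] to the outer boundary, it
    shows that the inner boundary is met strictly earlier; symmetrically for a
    point outside [M]. So comparing the two distances recovers [M] ([fill_Tr]).

    From a boundary pair [(D0, D1)] to a set and back. The heart is
    [boundary_pair_contact]: let [x] and [z] be equal or adjacent, [x] at least
    as close to [D0] as to [D1], and [z] at least as close to [D1] as to [D0].
    Shortest paths from [x] to [D0] and from [z] to [D1] meet [D0] and [D1] only
    in their far ends. Gluing them along the step from [x] to [z] gives a path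
    from [D0] to [D1] with no interior point in [D0] or [D1]; by the separation
    axiom it has no interior point at all, so [x] is in [D0] and [z] in [D1].
    Hence whenever a step leaves the set of points closer to [D0], it goes from
    [D0] to [D1], and the boundaries of that set are [D0] and [D1] ([Tr_fill]).

    The whole grid is the one nonempty set with empty boundaries; it corresponds
    to the pair [(set0, set0)], which is not a boundary pair. *)

Section GridMetric.
Set Implicit Arguments.
Unset Strict Implicit.
Context {R : realType} {m : nat} {rho : R} (hrho : 0 < rho).
Implicit Types (x y z u v w : 'rV[R]_m) (D M : set 'rV[R]_m).

(** * The maximum norm on the grid *)

Lemma rV_norm_le x (r : R) :
  0 <= r -> (forall j, `|x 0 j| <= r) -> `|x| <= r.
Proof.
move=> r0 xr; rewrite [leLHS]/Num.Def.normr/= mx_normrE.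
by apply: bigmax_le => // -[i j] _ /=; rewrite (ord1 i).
Qed.

Lemma rV_norm_ge x j : `|x 0 j| <= `|x|.
Proof.
rewrite [leRHS]/Num.Def.normr/= mx_normrE.
by apply/bigmax_geP; right => /=; exists (0, j).
Qed.

Lemma grid_dist_nat x z :
  grid m rho x -> grid m rho z -> exists n : nat, `|x - z| = n%:R * rho.
Proof.
move=> [k ->] [l ->]; rewrite /Num.Def.normr/= mx_normrE.
apply: (big_ind (fun r => exists n : nat, r = n%:R * rho)).
- by exists 0%N; rewrite mul0r.
- by move=> r s [a ->] [b ->]; rewrite maxEle; case: ifP; [exists b|exists a].
- move=> [i j] _ /=; exists `|k i j - l i j|%N.
  rewrite !mxE -mulrBr -intrB normrM (gtr0_norm hrho) mulrC.
  by rewrite natr_absz intr_norm.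
Qed.

(** In the maximum norm all coordinates can move at once, each one unit
    towards its target. *)
Lemma grid_step x z (n : nat) :
  grid m rho x -> grid m rho z -> `|x - z| <= n.+1%:R * rho ->
  exists y, [/\ grid m rho y, `|x - y| <= rho & `|y - z| <= n%:R * rho].
Proof.
move=> [k ->] [l ->] xz.
have kl j : (`|(k 0 j - l 0 j)%R| <= n.+1)%N.
  have := le_trans (rV_norm_ge _ j) xz.
  rewrite !mxE -mulrBr -intrB normrM (gtr0_norm hrho) mulrC ler_pM2r//.
  by rewrite -intr_norm -natr_absz ler_nat.
pose y : 'rV[int]_m := \row_j (k 0 j + sgz (l 0 j - k 0 j)).
exists (rho *: map_mx (fun a : int => a%:~R) y); split; first by exists y.
- apply: rV_norm_le => [|j]; first exact: ltW.
  rewrite !mxE -mulrBr -intrB normrM (gtr0_norm hrho) -intr_norm.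
  rewrite -[leRHS]mulr1 ler_pM2l// opprD addNKr normrN normr_sgz.
  by case: (_ != 0).
- apply: rV_norm_le => [|j]; first by rewrite mulr_ge0// ltW.
  rewrite !mxE -mulrBr -intrB normrM (gtr0_norm hrho) mulrC ler_pM2r//.
  rewrite -intr_norm -natr_absz ler_nat.
  by have := kl j; case: sgzP => //; lia.
Qed.

Lemma grid_adjacent x z : grid m rho x -> grid m rho z -> x <> z ->
  `|x - z| <= rho -> `|x - z| = rho.
Proof.
move=> gx gz xz; have [n e] := grid_dist_nat gx gz; rewrite e.
rewrite -[leRHS]mul1r ler_pM2r// lern1.
case: n e => [e|[|n] _ //]; last by rewrite mul1r.
by case: xz; apply/subr0_eq/normr0_eq0; rewrite e mul0r.
Qed.

Lemma grid_dist_ge x z : grid m rho x -> grid m rho z -> x <> z ->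
  rho <= `|x - z|.
Proof.
move=> gx gz xz; rewrite leNgt; apply/negP => h.
by have := grid_adjacent gx gz xz (ltW h); lra.
Qed.

(** * Distance from a point to a set of grid points *)

Lemma ptdistE x D : ptdist x D = ereal_inf [set (`|x - w|)%:E | w in D].
Proof. by rewrite /ptdist /setdist image_set1 ereal_sup1. Qed.

Lemma ptdist_set0 x : ptdist x set0 = +oo%E.
Proof. by rewrite ptdistE image_set0 ereal_inf0. Qed.

Lemma ptdist_le x w D : D w -> (ptdist x D <= `|x - w|%:E)%E.
Proof. by move=> Dw; rewrite ptdistE; apply: ereal_inf_lbound; exists w. Qed.

(** Distances between grid points are natural multiples of [rho], so the
    infimum is a least element of a set of natural numbers. *)
Lemma ptdist_attained x D : grid m rho x -> D `<=` grid m rho -> D !=set0 ->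
  exists2 u, D u & ptdist x D = `|x - u|%:E.
Proof.
move=> gx Dg [d Dd].
pose P (n : nat) := `[< exists2 u, D u & `|x - u| = n%:R * rho >].
have exP : exists n, P n.
  by have [n e] := grid_dist_nat gx (Dg _ Dd); exists n; apply/asboolP; exists d.
case: (ex_minnP exP) => n /asboolP[u Du xu] nmin; exists u => //.
apply/eqP; rewrite eq_le ptdist_le//= ptdistE.
apply: le_ereal_inf_tmp => _ [w Dw <-]; rewrite lee_fin xu.
have [k e] := grid_dist_nat gx (Dg _ Dw).
by rewrite e ler_pM2r// ler_nat; apply: nmin; apply/asboolP; exists w.
Qed.

(** * Paths in the grid *)

(** Discrete intermediate value property along a shortest path from [x] to [z].
    For [n * rho = `|x - z|] the bound on [`|x - y|] says that the last point
    before the exit from [P] is strictly closer to [x] than [z] is. *)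
Lemma grid_crossing (P : set 'rV[R]_m) n x z :
  grid m rho x -> grid m rho z -> P x -> ~ P z -> `|x - z| <= n%:R * rho ->
  exists y y', [/\ grid m rho y /\ P y, grid m rho y' /\ ~ P y',
    `|y - y'| = rho & `|x - y| + rho <= n%:R * rho].
Proof.
elim: n x => [|n IH] x gx gz Px nPz xz.
  case: nPz; suff <- : x = z by [].
  by apply/subr0_eq/normr0_eq0/le_anti; rewrite normr_ge0 andbT -(mul0r rho).
have [c [gc xc cz]] := grid_step gx gz xz.
have [Pc|nPc] := pselect (P c).
  have [y [y' [yP y'P yy' cy]]] := IH c gc gz Pc nPz cz.
  exists y, y'; split=> //; rewrite -natr1 mulrDl mul1r.
  by have := ler_distD c x y; lra.
exists x, c; split=> //.
  by apply: grid_adjacent => // e; rewrite e in Px.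
by rewrite subrr normr0 add0r ler_peMl ?ler1n ?ltW.
Qed.

(** Boolean, so that the concatenation and reversal lemmas for [path] apply. *)
Definition gridadj : rel 'rV[R]_m :=
  fun x y => `[< [/\ grid m rho x, grid m rho y & `|x - y| <= rho] >].

Lemma gridadj_sym : symmetric gridadj.
Proof.
by move=> x y; apply/asboolP/asboolP => -[? ?]; rewrite distrC.
Qed.

Lemma path_gridpaths x z s : grid m rho x -> path gridadj x (rcons s z) ->
  gridpaths rho x z (x :: rcons s z).
Proof.
move=> gx /(pathP 0) xs; split=> //.
- move=> xi; rewrite inE => /orP[/eqP->//|/(nthP 0)[i /xs/asboolP[_ + _] <-]].
  by [].
- by rewrite /pathlen/= size_rcons/= nth_rcons ltnn eqxx.
- case=> // l; rewrite /pathlen/= => /xs/asboolP[_ _].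
  by rewrite distrC.
Qed.

(** The separation axiom for a path written as [x], interior points [s], [z]:
    its length exceeds 1 exactly when [s] is nonempty. *)
Lemma boundary_pair_sep D0 D1 x z s : boundary_pair rho D0 D1 ->
  D0 x -> D1 z -> path gridadj x (rcons s z) -> s != [::] ->
  exists2 y, y \in s & (D0 `|` D1) y.
Proof.
move=> bp D0x D1z xsz s0.
have gx : grid m rho x by apply: (bp_sub bp).1.
have len : pathlen (x :: rcons s z) = (size s).+1.
  by rewrite /pathlen/= size_rcons.
have [|[|l]] // := bp_sep bp D0x D1z (path_gridpaths gx xsz).
  by rewrite len; case: (s) s0.
rewrite len/= ltnS nth_rcons => ls; rewrite ls => Dl.
by exists s`_l => //; exact: mem_nth.
Qed.

(** Walk from [u] to [x] in [n] steps. Every point after [u] has fewer than [n]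
    steps left, so it is closer to [x] than the points of [D] are. For
    [n * rho = `|x - u|] this says that a shortest path from a nearest point of
    [D] to [x] does not return to [D]. *)
Lemma free_approach D n x u : grid m rho x -> grid m rho u ->
  `|x - u| <= n%:R * rho -> (forall w, D w -> n%:R * rho <= `|x - w|) ->
  exists s, [/\ path gridadj u s, last u s = x & forall y, y \in s -> ~ D y].
Proof.
elim: n x => [|n IH] x gx gu xu far.
  exists [::]; split=> //=; apply/esym/subr0_eq/normr0_eq0/le_anti.
  by rewrite normr_ge0 andbT -(mul0r rho).
have [y [gy xy yu]] := grid_step gx gu xu.
have [|s [us ls sD]] := IH y gy gu yu.
  move=> w /far; rewrite -natr1 mulrDl mul1r.
  by have := ler_distD y x w; lra.
exists (rcons s x); split; last 1 first.
- move=> v; rewrite mem_rcons inE => /orP[/eqP-> /far|]; last exact: sD.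
  by rewrite subrr normr0 leNgt mulr_gt0// ltr0n.
- rewrite rcons_path us ls /=; apply/asboolP; split=> //.
  by rewrite distrC.
- by rewrite last_rcons.
Qed.

Lemma free_approach_nearest D0 D1 x : grid m rho x -> D0 `<=` grid m rho ->
  D0 !=set0 -> (ptdist x D0 <= ptdist x D1)%E ->
  exists u s, [/\ D0 u, path gridadj u s, last u s = x &
    forall y, y \in s -> ~ (D0 `|` D1) y].
Proof.
move=> gx D0g D0n le01.
have [u D0u xu] := ptdist_attained gx D0g D0n.
have gu := D0g _ D0u; have [n e] := grid_dist_nat gx gu.
have [||s [us lus sD]] := @free_approach (D0 `|` D1) n x u gx gu.
- by rewrite e.
- move=> w Dw; rewrite -e -lee_fin -xu.
  by case: Dw => Dw; [|apply: (le_trans le01)]; exact: ptdist_le.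
- by exists u, s; split.
Qed.

(** Taking [x = z] is allowed: as [D0] and [D1] are disjoint, the statement then
    excludes grid points equidistant from both. *)
Lemma boundary_pair_contact D0 D1 x z : boundary_pair rho D0 D1 ->
  grid m rho x -> grid m rho z -> `|x - z| <= rho ->
  (ptdist x D0 <= ptdist x D1)%E -> (ptdist z D1 <= ptdist z D0)%E ->
  D0 x /\ D1 z.
Proof.
move=> bp gx gz xz x01 z10.
have [[D0g D1g] [D0n D1n]] := (bp_sub bp, bp_neq0 bp).
have [u [s [D0u us lus sD]]] := free_approach_nearest gx D0g D0n x01.
have [v [t [D1v vt lvt tD]]] := free_approach_nearest gz D1g D1n z10.
have rt : rcons (rev t) v = last v t :: rev (belast v t).
  by rewrite -rev_cons -rev_rcons -lastI.
(* s ++ rev t are the interior points of the glued path from u to v. *)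
have st0 : s ++ rev t = [::].
  apply/eqP/negPn/negP => st0.
  have [|y] := boundary_pair_sep bp D0u D1v _ st0.
    rewrite rcons_cat cat_path us rt/= lus lvt; apply/andP; split.
      exact/asboolP.
    rewrite -lvt rev_path -(eq_path (e := gridadj))// => a b.
    exact: gridadj_sym.
  rewrite mem_cat mem_rev => /orP[/sD|/tD//]; first exact.
  by rewrite setUC.
have [/eqP s0 /eqP t0] : s == [::] /\ t == [::].
  apply/andP; rewrite -!size_eq0 -addn_eq0 -(size_rev t) -size_cat.
  by rewrite st0.
by rewrite s0 t0/= in lus lvt; subst.
Qed.


(** * The boundaries of a set of grid points *)

(** The distance of [z] to the inner boundary is at most [rho] because of [x],
    and at least [rho] because [z], being outside [M], is not in it. *)
Lemma bdry_adjacent M x z : M `<=` grid m rho -> M x -> grid m rho z -> ~ M z ->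
  `|x - z| <= rho -> bdry0 rho M x /\ bdry1 rho M z.
Proof.
move=> Mg Mx gz nMz xz; have gx := Mg _ Mx.
have {}xz : `|x - z| = rho by apply: grid_adjacent => // e; rewrite e in Mx.
have bx : bdry0 rho M x by split=> //; exists z.
split=> //; split=> //; apply/eqP; rewrite eq_le; apply/andP; split.
  by apply: (le_trans (ptdist_le z bx)); rewrite distrC xz.
have [||u [Mu _] ->] := @ptdist_attained z (bdry0 rho M) gz.
- by move=> u [/Mg].
- by exists x.
- rewrite lee_fin; apply: grid_dist_ge => //; first exact: Mg.
  by move=> e; rewrite e in nMz.
Qed.

(** The inner boundary is nonempty here, since the distance to the empty set
    would be infinite. *)
Lemma bdry1_neighbor M z : M `<=` grid m rho -> bdry1 rho M z ->
  exists2 x, bdry0 rho M x & `|x - z| = rho.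
Proof.
move=> Mg [[_ gz] zM].
have [b0|b0] := eqVneq (bdry0 rho M) set0; first by rewrite b0 ptdist_set0 in zM.
have [||u bu zu] := @ptdist_attained z (bdry0 rho M) gz.
- by move=> u [/Mg].
- exact/set0P.
- by exists u => //; move: zM; rewrite zu distrC => -[].
Qed.

(** For the separation of paths, consider the step on which the path first leaves
    [M]: both its ends are boundary points, and a path of length greater than 1
    has one of them in its interior. *)
Lemma Tr_boundary_pair M a b : M `<=` grid m rho -> M a -> grid m rho b ->
  ~ M b -> boundary_pair rho (bdry0 rho M) (bdry1 rho M).
Proof.
move=> Mg Ma gb nMb; split.
- by split=> [x [/Mg]|z [[]]].
- have [n ab] := grid_dist_nat (Mg _ Ma) gb.
  have [|y [y' [[gy My] [gy' nMy'] yy' _]]] :=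
    grid_crossing (Mg _ Ma) gb Ma nMb (n := n); first by rewrite ab.
  have [|b0 b1] := bdry_adjacent Mg My gy' nMy'; first by rewrite yy'.
  by split; [exists y|exists y'].
- by rewrite -subset0 => x [[Mx _] [[]]].
- move=> x [Mx [z [nMz gz] xz]]; exists z => //.
  by have [|_] := bdry_adjacent Mg Mx gz nMz; rewrite ?xz.
- by move=> z /(bdry1_neighbor Mg).
- move=> x z p [Mx _] [[nMz _] _] [_ pg p0 pz pstep] len.
  (* l is the index of the first point of the path outside M. *)
  have exl : exists l, `[< ~ M p`_l >].
    by exists (pathlen p); apply/asboolP; rewrite pz.
  case: (ex_minnP exl) => l /asboolP nMl lmin.
  have lp : (l <= pathlen p)%N by apply: lmin; apply/asboolP; rewrite pz.
  case: l nMl lmin lp => [|l] nMl lmin lp; first by rewrite p0 in nMl.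
  have Ml : M p`_l.
    by apply: contrapT => nM; have := lmin l (asboolT nM); rewrite ltnn.
  have gl : grid m rho p`_l.+1.
    by apply/pg/mem_nth; move: lp len; rewrite /pathlen; case: (size p).
  have [|b0 b1] := bdry_adjacent Mg Ml gl nMl; first by rewrite distrC; exact: pstep.
  move: lp; rewrite leq_eqVlt => /orP[/eqP lp|lp]; last first.
    by exists l.+1 => //; right.
  by exists l; [lia|left].
Qed.

(** A shortest path from a point of [M] to the outer boundary must step out of
    [M], and the last point before that step is in the inner boundary, which is
    therefore closer. The same holds with [M] and its complement, and the two
    boundaries, exchanged. *)
Lemma fill_Tr M a b : M `<=` grid m rho -> M a -> grid m rho b ->
  ~ M b -> fill rho (bdry0 rho M) (bdry1 rho M) = M.
Proof.
move=> Mg Ma gb nMb.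
have bp := Tr_boundary_pair Mg Ma gb nMb.
have [[D0g D1g] [D0n D1n]] := (bp_sub bp, bp_neq0 bp).
apply/seteqP; split=> x.
- case=> gx; apply: contraPP => nMx; apply/negP; rewrite -leNgt ltW//.
  have [u [Mu bu] xu] := ptdist_attained gx D0g D0n.
  have [n e] := grid_dist_nat gx (Mg _ Mu).
  have [||y [y' [[gy nMy] [gy' /contrapT My'] yy' xy]]] :=
    @grid_crossing (~` M) n x u gx (Mg _ Mu) nMx; rewrite ?e//.
  have [|_ b1] := bdry_adjacent Mg My' gy nMy; first by rewrite distrC yy'.
  rewrite xu e; apply: (le_lt_trans (ptdist_le _ b1)).
  by rewrite lte_fin (lt_le_trans _ xy)// ltrDl.
- move=> Mx; have gx := Mg _ Mx; split=> //.
  have [v bv xv] := ptdist_attained gx D1g D1n.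
  have [[nMv gv] _] := bv.
  have [n e] := grid_dist_nat gx gv.
  have [|y [y' [[gy My] [gy' nMy'] yy' xy]]] :=
    @grid_crossing M n x v gx gv Mx nMv; rewrite ?e//.
  have [|b0 _] := bdry_adjacent Mg My gy' nMy'; first by rewrite yy'.
  rewrite xv e; apply: (le_lt_trans (ptdist_le _ b0)).
  by rewrite lte_fin (lt_le_trans _ xy)// ltrDl.
Qed.

(** * The set enclosed by a boundary pair *)

Lemma sub_fill D0 D1 : boundary_pair rho D0 D1 -> D0 `<=` fill rho D0 D1.
Proof.
move=> bp x D0x; have [[D0g D1g] [_ D1n]] := (bp_sub bp, bp_neq0 bp).
have gx := D0g _ D0x; split=> //.
have [v D1v ->] := ptdist_attained gx D1g D1n.
apply: (le_lt_trans (ptdist_le _ D0x)); rewrite subrr normr0 lte_fin.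
apply: (lt_le_trans hrho); apply: grid_dist_ge => //; first exact: D1g.
by move=> e; rewrite -e in D1v; have : (D0 `&` D1) x by []; rewrite (bp_disj bp).
Qed.

Lemma fill_disj D0 D1 z : boundary_pair rho D0 D1 -> D1 z ->
  ~ fill rho D0 D1 z.
Proof.
move=> bp D1z; have [[D0g D1g] [D0n _]] := (bp_sub bp, bp_neq0 bp).
case=> gz; apply/negP; rewrite -leNgt.
have [u D0u ->] := ptdist_attained gz D0g D0n.
by apply: (le_trans (ptdist_le _ D1z)); rewrite subrr normr0 lee_fin.
Qed.

(** A step leaving the fill satisfies the comparisons of
    [boundary_pair_contact], so it goes from [D0] to [D1]; conversely each point
    of [D0] has a neighbour in [D1] and vice versa, and these lie on different
    sides of the fill. *)
Lemma Tr_fill D0 D1 : boundary_pair rho D0 D1 ->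
  Tr rho (fill rho D0 D1) = (D0, D1).
Proof.
move=> bp; have [D0g D1g] := bp_sub bp.
have Mg : fill rho D0 D1 `<=` grid m rho by move=> ? [].
have contact x z : fill rho D0 D1 x -> grid m rho z -> ~ fill rho D0 D1 z ->
    `|x - z| = rho -> D0 x /\ D1 z.
  move=> [gx x01] gz nz xz.
  apply: boundary_pair_contact => //; [by rewrite xz|exact: ltW|].
  by rewrite leNgt; apply/negP => z01; apply: nz.
congr pair; apply/seteqP; split.
- by move=> x [fx [z [nfz gz] xz]]; case: (contact x z).
- move=> x D0x; have [z D1z xz] := bp_out bp D0x.
  by split; [exact: sub_fill|exists z => //; split; [exact: fill_disj|exact: D1g]].
- move=> z bz; have [x [fx _] xz] := bdry1_neighbor Mg bz.
  by case: bz => -[nfz gz] _; case: (contact x z).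
- move=> z D1z; have [x D0x xz] := bp_in bp D1z.
  have [||_ //] := bdry_adjacent Mg (sub_fill bp D0x) (D1g _ D1z).
    exact: fill_disj.
  by rewrite xz.
Qed.

(** * The bijection *)

Lemma Tr_grid : Tr rho (grid m rho) = (set0, set0).
Proof.
congr pair; rewrite -subset0; first by move=> x [_ [z []]].
by move=> z [[]].
Qed.

Lemma not_bd_minus0 : ~ bd_minus m rho (set0, set0).
Proof. by move=> /bp_neq0[[]]. Qed.

Lemma bd_Tr M : Sne m rho M -> bd m rho (Tr rho M).
Proof.
move=> [Mg [a Ma]].
have [gM|/existsNP[b /not_implyP[gb nMb]]] := pselect (grid m rho `<=` M).
  by right; rewrite /= -Tr_grid; congr Tr; apply/seteqP.
by left; exact: (Tr_boundary_pair Mg Ma gb nMb).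
Qed.

Lemma TrK M : Sne m rho M -> Tr_inv rho (Tr rho M) = M.
Proof.
move=> [Mg [a Ma]].
have [gM|/existsNP[b /not_implyP[gb nMb]]] := pselect (grid m rho `<=` M).
  have -> : M = grid m rho by apply/seteqP.
  by rewrite Tr_grid /Tr_inv asboolF//; exact: not_bd_minus0.
rewrite /Tr_inv asboolT; first exact: (fill_Tr Mg Ma gb nMb).
exact: (Tr_boundary_pair Mg Ma gb nMb).
Qed.

Lemma Tr_invK (D : set 'rV[R]_m * set 'rV[R]_m) :
  bd m rho D -> Tr rho (Tr_inv rho D) = D.
Proof.
case: D => D0 D1 [bp|[-> ->]]; rewrite /Tr_inv.
  by rewrite asboolT//; exact: Tr_fill.
by rewrite asboolF ?Tr_grid//; exact: not_bd_minus0.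
Qed.

Lemma Sne_Tr_inv (D : set 'rV[R]_m * set 'rV[R]_m) :
  bd m rho D -> Sne m rho (Tr_inv rho D).
Proof.
case: D => D0 D1 [bp|[-> ->]]; rewrite /Tr_inv.
  rewrite asboolT//; split=> [x []//|].
  by have [[x D0x] _] := bp_neq0 bp; exists x; exact: sub_fill.
rewrite asboolF; last exact: not_bd_minus0.
by split=> //; exists 0; exists 0; rewrite raddf0 scaler0.
Qed.

End GridMetric.

Theorem theorem19 (R : realType) (m : nat) (hm : (0 < m)%N)
    (rho : R) (hrho : 0 < rho) :
  [/\ Tr rho @` Sne m rho = bd m rho,
      set_bij (Sne m rho) (bd m rho) (Tr rho),
      set_fun (bd m rho) (Sne m rho) (Tr_inv rho),
      (forall M, Sne m rho M -> Tr_inv rho (Tr rho M) = M) &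
      (forall D, bd m rho D -> Tr rho (Tr_inv rho D) = D)].
Proof.
have surj : bd m rho `<=` Tr rho @` Sne m rho.
  move=> D bD; exists (Tr_inv rho D); [exact: Sne_Tr_inv|exact: Tr_invK].
split; [|split| | |].
- by apply/seteqP; split=> // _ [M MS <-]; exact: bd_Tr.
- exact: bd_Tr.
- move=> M N /[!inE] MS NS e.
  by rewrite -(TrK hrho MS) e TrK.
- exact: surj.
- exact: Sne_Tr_inv.
- exact: TrK.
- exact: Tr_invK.
Qed.
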